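(* Let $\mathcal{A}$ be an associative $\mathbb{Z}^n$-graded commutative unital algebra and $\alpha\in\mathbb{Z}^n$. The Grabowski-Marmo bracket $[-,-]^{\mathrm{GM}}$ is the restriction to $\mathfrak{Diff}_1(\mathcal{A})$ of the pullback $\sim^*[-,-]^\otimes|_{A(W)}$ of the restriction of the stem bracket to graded skew-symmetric multilinear maps on the shifted space $W$; that is, for all $A,B\in\mathfrak{Diff}_1(\mathcal{A})$, $[A,B]^{\mathrm{GM}}$ is the map whose image under $\sim$ is $[\tilde A,\tilde B]^\otimes|_{A(W)}$.
   Context: Vector spaces are over a field $\mathbb{K}$ of characteristic $0$; $\langle\alpha,\beta\rangle=\sum_i\alpha_i\beta_i$. A homogeneous vector or map and its degree/weight are denoted by the same symbol; $e_1=(1,0,\ldots,0)\in\mathbb{Z}^n$. $N^{(p)}=(1,\ldots,p)$; in sums $I,J,K$ are pairwise disjoint naturally ordered subsets with the given union; $(-1)^{(I;J)}$ is the signature of the permutation rearranging the concatenation $(I;J)$ into increasing order and $\varepsilon_V(I;J)$ is the corresponding Koszul sign. Operators on $\mathcal{A}$. For $a\ge0$, $\mathfrak{A}^{(A+\alpha a,a)}(\mathcal{A})$ is the space of $(a+1)$-linear maps $\mathcal{A}^{\times(a+1)}\to\mathcal{A}$ of weight $A$ that are $\alpha$-antisymmetric (exchanging adjacent homogeneous arguments $v,w$ gives the sign $-(-1)^{\langle v+\alpha,w+\alpha\rangle}$); for $a=-1$ it is $\mathcal{A}^A$. $\mathfrak{Diff}_1^{(A+\alpha a,a)}(\mathcal{A})$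 is the subspace of graded first order polydifferential operators: for $a\ge0$ and fixed homogeneous $v_1,\ldots,v_a$, $D=A(v_1,\ldots,v_a,-)$ satisfies $D(vw)=D(v)w+(-1)^{\langle D,v\rangle}vD(w)-D(1)vw$; for $a=-1$ it is $\mathcal{A}^A$. $\mathfrak{Diff}_1(\mathcal{A})$ is the direct sum of these spaces. Write $A(v)=A(v,-,\ldots,-)$. The Grabowski-Marmo bracket on $\mathfrak{Diff}_1(\mathcal{A})$ is the bilinear bracket determined inductively by $[v,w]^{\mathrm{GM}}=0$, $[A,v]^{\mathrm{GM}}=(-1)^{1-a}A(v)$, $[v,A]^{\mathrm{GM}}=-(-1)^{\langle v-\alpha,A+\alpha a\rangle+a}[A,v]^{\mathrm{GM}}$ ($v,w\in\mathcal{A}$ homogeneous, $a\ge0$) and $[A,B]^{\mathrm{GM}}(v)=(-1)^a[A,B(v)]^{\mathrm{GM}}+(-1)^{\langle B+\alpha b,v-\alpha\rangle}[A(v),B]^{\mathrm{GM}}$ ($a,b\ge0$). Shift. $W$ (denoted $\downarrow\mathcal{A}$ in the paper) is $\mathcal{A}$ with the grading $W^\gamma=\mathcal{A}^{\gamma+\alpha}$; let $s:\mathcal{A}\to W$ be the identity map regarded as a shift of degree. $A^{(C,a)}(W)$, $a\ge0$, is the space of weight $C$ graded skew-symmetric $(a+1)$-linear maps on $W$ (exchanging adjacent $w,w'$ gives $-(-1)^{\langle w,w'\rangle}$), $A^{(C,-1)}(W)=W^C$, and $A(W)$ is the direct sum. The isomorphism $\sim:\mathfrak{A}^{(A+\alpha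 a,a)}(\mathcal{A})\to A^{(A+\alpha a,a)}(W)$ is $\tilde A(w_1,\ldots,w_{a+1})=sA(s^{-1}w_1,\ldots,s^{-1}w_{a+1})$. Stem bracket on a graded space $V$ (used with $V=W$). $M^{(C,a)}(V)$, $a\ge0$, is the space of $(a+1)$-linear maps on $V$ of weight $C$. For a graded space $U$, $T(U)=\bigoplus_{p\ge1}U^{\otimes p}$ has coproduct $\Delta(u_1\otimes\ldots\otimes u_p)=\sum_{I\cup J=N^{(p-1)},\,I\ne\emptyset}\varepsilon_U(I;J)U_I\bigotimes U_J\otimes u_p$, $U_I=u_{i_1}\otimes\ldots\otimes u_{i_{|I|}}$. Tensor products of maps: $(f\otimes g)(v_1\otimes v_2)=(-1)^{\langle g,v_1\rangle}f(v_1)\otimes g(v_2)$. A weight $Q$ coderivation is a weight $Q$ linear map with $\Delta Q=(Q\otimes\mathrm{id}+\mathrm{id}\otimes Q)\Delta$; it is determined by arbitrary weight $Q$ corestrictions $Q_p:U^{\otimes p}\to U$ via $Q(u_1\otimes\ldots\otimes u_p)=\sum_{I\cup J\cup K=N^{(p)},\,I,J<K}\varepsilon_U(I;J)(-1)^{\langle Q,U_I\rangle}U_I\otimes Q_{|J|+1}(U_J\otimes u_{k_1})\otimes U_{K\setminus k_1}$ ($I,J$ possibly empty, $K=(k_1<k_2<\ldots)$ nonempty, $I<K$: last element of $I$ smaller than $k_1$). Let $\downarrow V$ be $V$ with grading $(\downarrow V)^\gamma=V^{\gamma+e_1}$, with $\downarrow:V\to\downarrow V$ of weight $-e_1$ and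 inverse $\uparrow$. For $A\in M^{(A,a)}(V)$, $\phi_{(A,a)}(A)$ is the weight $A+ae_1$ coderivation of $T(\downarrow V)$ whose only (possibly) nonzero corestriction is $(-1)^{a(a+1)/2}\downarrow\circ A\circ\uparrow^{\otimes(a+1)}$. The stem bracket is $[A,B]^\otimes=(-1)^{1+\langle ae_1,be_1+B\rangle}\phi_{(A+B,a+b)}^{-1}([\phi_{(A,a)}(A),\phi_{(B,b)}(B)])$, $a,b\ge0$, with the graded commutator $[Q,Q']=QQ'-(-1)^{\langle Q,Q'\rangle}Q'Q$ on the right. Bracket on $A(V)$. On $A(V)$, $[-,-]^\otimes|_{A(V)}$ is the stem bracket for $a,b\ge0$; it coincides there with the graded Nijenhuis-Richardson bracket, and is understood as that bracket when $a=-1$ or $b=-1$: $[v,w]=0$, $[A,v]=(-1)^{1-a}A(v,-,\ldots,-)$ and $[v,A]=-(-1)^{\langle v,A\rangle+a}[A,v]$ for homogeneous $v,w\in V$ and $A\in A^{(A,a)}(V)$, $a\ge0$. *)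

(* Defs.v *)
From HB Require Import structures.
From mathcomp Require Import all_boot all_order all_algebra.
From mathcomp Require Import classical_sets fsbigop.

Set Implicit Arguments.
Unset Strict Implicit.
Unset Printing Implicit Defensive.

Import Order.TTheory GRing.Theory Num.Theory.
Local Open Scope ring_scope.

(* Degrees are nonempty integer vectors, since e_1 has to exist. *)
Notation deg n := 'rV[int]_n.+1.

Definition pdot (n : nat) (g h : deg n) : int := \sum_i g 0 i * h 0 i.

Definition e1 (n : nat) : deg n := delta_mx 0 0.

Definition sgn (K : fieldType) (z : int) : K := (-1) ^ z.

(* A direct sum decomposition of V into subspaces indexed by deg n, given by
   its projections.  [hsupp v] lists the degrees of the nonzero components. *)
Record grading (K : fieldType) (n : nat) (V : lmodType K) := Grading {
  hcomp : deg n -> V -> V;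
  hsupp : V -> seq (deg n);
  hcomp_linear : forall g, linear (hcomp g);
  hcomp_comp : forall g h v, hcomp g (hcomp h v) = if g == h then hcomp h v else 0;
  hsupp_uniq : forall v, uniq (hsupp v);
  mem_hsupp : forall v g, (g \in hsupp v) = (hcomp g v != 0);
  hcomp_sum : forall v, v = \sum_(g <- hsupp v) hcomp g v }.

Record gspace (K : fieldType) (n : nat) := GSpace {
  gcar :> lmodType K;
  gstr : grading n gcar }.

Section Graded.
Variables (K : fieldType) (n : nat).
Implicit Types (V : gspace K n) (g h C D : deg n).

(* v belongs to the component of degree g (0 belongs to all of them). *)
Definition homog V g (v : V) : Prop := hcomp (gstr V) g v = v.

(* Homogeneous vectors are listed together with a degree. *)
Definition homogs V (l : seq (deg n * V)) : Prop :=
  forall x, x \in l -> homog x.1 x.2.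

Definition vals (T : Type) (l : seq (deg n * T)) : seq T := [seq x.2 | x <- l].

Definition tot (T : Type) (l : seq (deg n * T)) : deg n := \sum_(x <- l) x.1.

(* Multilinear extension of a map given on homogeneous vectors. *)
Fixpoint hext V (f : seq (deg n * V) -> V) (l : seq V) : V :=
  if l is v :: l' then
    \sum_(g <- hsupp (gstr V) v)
       hext (fun l2 => f ((g, hcomp (gstr V) g v) :: l2)) l'
  else f [::].

(** Shifted spaces *)

Section ShiftGrading.
Variables (d : deg n) (V : lmodType K) (gr : grading n V).

Let sc g := hcomp gr (g + d).
Let ss (v : V) := [seq g - d | g <- hsupp gr v].

Fact shift_linear g : linear (sc g).
Proof. exact: hcomp_linear. Qed.

Fact shift_comp g h v : sc g (sc h v) = if g == h then sc h v else 0.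
Proof. by rewrite /sc hcomp_comp (inj_eq (addIr d)). Qed.

Fact shift_uniq v : uniq (ss v).
Proof. by rewrite map_inj_uniq ?hsupp_uniq //; exact: addIr. Qed.

Fact shift_mem v g : (g \in ss v) = (sc g v != 0).
Proof.
by rewrite /sc -mem_hsupp -{1}(addrK d g) (mem_map (addIr (- d))).
Qed.

Fact shift_sum v : v = \sum_(g <- ss v) sc g v.
Proof.
rewrite big_map [LHS](hcomp_sum gr v).
by apply: eq_bigr => g _; rewrite /sc subrK.
Qed.

Definition shift_grading : grading n V :=
  Grading shift_linear shift_comp shift_uniq shift_mem shift_sum.

End ShiftGrading.

(* The component of degree g of [shiftg d V] is that of degree g + d of V. *)
Definition shiftg (d : deg n) V : gspace K n := GSpace (shift_grading d (gstr V)).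

(* The identity map, of weight - d, and its inverse, of weight d. *)
Definition sh d V : V -> shiftg d V := id.
Definition unsh d V : shiftg d V -> V := id.

(** Families of multilinear maps

   A p-linear map on V is a function on lists that vanishes off the lists of
   length p; an element of V is the case p = 0.  An element of a direct sum of
   spaces X^(C, a), a >= -1, is a family F with F p C in X^(C, p - 1), almost
   all of whose members vanish. *)

Definition ofam V := nat -> deg n -> seq V -> V.

Definition arity V (p : nat) (F : seq V -> V) : Prop :=
  forall l, size l != p -> F l = 0.

Definition multilinear V (F : seq V -> V) : Prop :=
  forall l1 l2 (c : K) (u v : V),
    F (l1 ++ (c *: u + v) :: l2) = c *: F (l1 ++ u :: l2) + F (l1 ++ v :: l2).

Definition weight V (p : nat) (A : deg n) (F : seq V -> V) : Prop :=
  forall l, homogs l -> size l = p -> homog (A + tot l) (F (vals l)).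

Definition antisym V (alpha : deg n) (F : seq V -> V) : Prop :=
  forall l1 l2 g h (v w : V), homog g v -> homog h w ->
    F (l1 ++ v :: w :: l2)
    = - sgn K (pdot (g + alpha) (h + alpha)) *: F (l1 ++ w :: v :: l2).

Definition fin_supp V (F : ofam V) : Prop :=
  exists s : seq (nat * deg n),
    forall p C, (p, C) \notin s -> forall l, F p C l = 0.

(* Bilinear extension of a bracket of homogeneous maps.  Such a bracket takes
   the number of arguments and the upper index C of each map, adds the indices,
   and sends p and q arguments to p + q - 1; its value is described on
   homogeneous vectors. *)
Definition famext V
    (br : nat -> deg n -> (seq V -> V) -> nat -> deg n -> (seq V -> V) ->
          seq (deg n * V) -> V) (F G : ofam V) : ofam V :=
  fun r C => hext (fun l =>
    \sum_(p < r.+2) \sum_(D \in [set: deg n])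
       br p D (F p D) (r.+1 - p)%N (C - D) (G (r.+1 - p)%N (C - D)) l).

(** Grabowski-Marmo bracket *)

(* Here C and D are the upper indices A + alpha a and B + alpha b, and passing
   from A to A(v) adds v - alpha to the index. *)
Fixpoint gmh V (alpha : deg n) (p : nat) C (F : seq V -> V)
    (q : nat) D (G : seq V -> V) (l : seq (deg n * V)) {struct l} : V :=
  match p, q with
  | 0, 0 => 0
  | a.+1, 0 => sgn K (1 - a%:Z) *: F (G [::] :: vals l)
  | 0, b.+1 =>
      - sgn K (pdot C D + b%:Z) *: (sgn K (1 - b%:Z) *: G (F [::] :: vals l))
  | a.+1, b.+1 =>
      if l is (g, v) :: l' then
        sgn K a%:Z *: gmh alpha p C F b (D + (g - alpha)) (fun x => G (v :: x)) l'
        + sgn K (pdot D (g - alpha)) *: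
            gmh alpha a (C + (g - alpha)) (fun x => F (v :: x)) q D G l'
      else 0
  end.

Definition gm_bracket V (alpha : deg n) : ofam V -> ofam V -> ofam V :=
  famext (gmh alpha).

Definition tilde V (alpha : deg n) (F : ofam V) : ofam (shiftg alpha V) :=
  fun p C l => sh alpha (F p C [seq unsh w | w <- l]).

(** Stem bracket

   An element of T(U) is represented by a formal linear combination of words
   u_1 ... u_p in homogeneous vectors of U, each listed with its degree.  Words
   are not identified under multilinearity: a map on T(U) is only used through
   its corestrictions, which are multilinear in the letters of a word. *)

Section Coderivations.
Variable U : gspace K n.

Notation word := (seq (deg n * U)).
Notation tens := (seq (K * word)).

Definition subword (w : word) (I : {set 'I_(size w)}) : word :=
  [seq tnth (in_tuple w) i | i <- enum I].

Definition koszul (w : word) (I J : {set 'I_(size w)}) : K :=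
  \prod_(i in I) \prod_(j in J | (j < i)%N)
     sgn K (pdot (tnth (in_tuple w) i).1 (tnth (in_tuple w) j).1).

Definition before (p : nat) (k : 'I_p) : {set 'I_p} := finset (fun i : 'I_p => (i < k)%N).

(* The weight Q coderivation with corestrictions q, for the coproduct
     u_1 ... u_p |-> sum over I u J = {1, ..., p - 1} with I nonempty of
       eps(I; J) U_I (x) U_J u_p,
   on a word w = u_1 ... u_p:
     sum over I u J u K = {1, ..., p} with I, J < K of
       eps(I; J) (-1)^<Q, U_I> U_I q(U_J u_k1) U_(K minus k1).
   The condition I, J < K says that K consists of all the indices from its
   first element k = k1 on, so that I and J partition the indices before k. *)
Definition coder (Q : deg n) (q : word -> U) (w : word) : tens :=
  let term (k : 'I_(size w)) (I : {set 'I_(size w)}) :=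
    let J := before k :\: I in
    let uk := tnth (in_tuple w) k in
    (koszul I J * sgn K (pdot Q (tot (subword I))),
     subword I ++
     (Q + (tot (subword J) + uk.1), q (subword J ++ [:: uk])) :: drop k.+1 w) in
  [seq term k X | k <- enum 'I_(size w), X <- enum (powerset (before k))].

Definition text (X : word -> tens) (t : tens) : tens :=
  [seq (c.1 * d.1, d.2) | c <- t, d <- X c.2].

Definition tscale (a : K) (t : tens) : tens := [seq (a * c.1, c.2) | c <- t].

Definition gcomm (Q Q' : deg n) (X X' : word -> tens) (w : word) : tens :=
  text X (X' w) ++ tscale (- sgn K (pdot Q Q')) (text X' (X w)).

(* The projection T(U) -> U. *)
Definition tproj (t : tens) : U :=
  \sum_(c <- t) (if c.2 is [:: u] then c.1 *: u.2 else 0).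

End Coderivations.

Notation down V := (shiftg (e1 n) V).

(* The sign in the tensor power of the map unsh : down V -> V of weight e_1,
   which sends u_1 ... u_m to [upsgn] times the word of the unsh u_i; by
   (f (x) g)(u (x) v) = (-1)^<g, u> f(u) (x) g(v), moving the last m - 1 factors
   past u_1 costs (-1)^<(m - 1) e_1, u_1>. *)
Fixpoint upsgn (T : Type) (w : seq (deg n * T)) : K :=
  if w is u :: w' then sgn K (pdot (e1 n *+ size w') u.1) * upsgn w' else 1.

Definition phi V (A : deg n) (a : nat) (F : seq V -> V) :
    seq (deg n * down V) -> seq (K * seq (deg n * down V)) :=
  coder (A + e1 n *+ a)
    (fun w => (-1) ^+ (a * a.+1)./2 *:
       sh (e1 n) (upsgn w *: F [seq unsh u.2 | u <- w])).

(* The (c+1)-linear map H such that (-1)^(c(c+1)/2) sh o H o unsh^(x)(c+1) is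
   the corestriction of R. *)
Definition phi_inv V (c : nat)
    (R : seq (deg n * down V) -> seq (K * seq (deg n * down V)))
    (l : seq (deg n * V)) : V :=
  let w := [seq (x.1 - e1 n, sh (e1 n) x.2) | x <- l] in
  ((-1) ^+ (c * c.+1)./2 / upsgn w) *: unsh (tproj (R w)).

Definition stemh V (a : nat) (A : deg n) (F : seq V -> V)
    (b : nat) (B : deg n) (G : seq V -> V) (l : seq (deg n * V)) : V :=
  sgn K (1 + pdot (e1 n *+ a) (e1 n *+ b + B)) *:
  phi_inv (a + b)
    (gcomm (A + e1 n *+ a) (B + e1 n *+ b) (phi A a F) (phi B b G)) l.

(* The bracket on A(V) for homogeneous maps with p and q arguments. *)
Definition skewh V (p : nat) C (F : seq V -> V) (q : nat) D (G : seq V -> V)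
    (l : seq (deg n * V)) : V :=
  match p, q with
  | 0, 0 => 0
  | a.+1, 0 => sgn K (1 - a%:Z) *: F (G [::] :: vals l)
  | 0, b.+1 =>
      - sgn K (pdot C D + b%:Z) *: (sgn K (1 - b%:Z) *: G (F [::] :: vals l))
  | a.+1, b.+1 => stemh a C F b D G l
  end.

Definition skew_bracket V : ofam V -> ofam V -> ofam V := famext (@skewh V).

(** Graded commutative algebras and first order operators *)

Record graded_comm (A : algType K) (gr : grading n A) : Prop := GradedComm {
  gone : @homog (GSpace gr) 0 1;
  gmul : forall g h (u v : A), @homog (GSpace gr) g u -> @homog (GSpace gr) h v ->
    @homog (GSpace gr) (g + h) (u * v);
  gcom : forall g h (u v : A), @homog (GSpace gr) g u -> @homog (GSpace gr) h v ->
    u * v = sgn K (pdot g h) *: (v * u) }.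

(* D = F(l, -) is a first order operator for all homogeneous l, where F has
   p arguments and weight A. *)
Definition first_order (A : algType K) (gr : grading n A) (p : nat) (wt : deg n)
    (F : seq A -> A) : Prop :=
  forall (l : seq (deg n * A)) g (v w : A),
    @homogs (GSpace gr) l -> (size l).+1 = p -> @homog (GSpace gr) g v ->
    let D x := F (rcons (vals l) x) in
    D (v * w) = D v * w + sgn K (pdot (wt + tot l) g) *: (v * D w)
                - D 1 * v * w.

(* The space with upper index (C, p - 1), C = wt + alpha (p - 1). *)
Definition diff1 (A : algType K) (gr : grading n A) (alpha : deg n)
    (p : nat) C (F : seq A -> A) : Prop :=
  let wt := C - alpha *~ (p%:Z - 1) in
  [/\ @arity (GSpace gr) p F,
      @multilinear (GSpace gr) F,
      @weight (GSpace gr) p wt F,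
      @antisym (GSpace gr) alpha F
    & first_order gr p wt F].

Definition Diff1 (A : algType K) (gr : grading n A) (alpha : deg n)
    (F : ofam (GSpace gr)) : Prop :=
  fin_supp F /\ forall p C, diff1 gr alpha p C (F p C).

End Graded.

Arguments tilde {K n V} alpha F.
Arguments gm_bracket {K n V} alpha F G.
Arguments skew_bracket {K n V} F G.

(* Main.v *)
Require Import Defs.
From mathcomp Require Import all_boot all_order all_algebra.
From mathcomp Require Import ring.
From mathcomp Require Import boolp fsbigop.

(** Both brackets are bilinear extensions of brackets of homogeneous maps, and
    they agree by definition when one of the two maps is a vector.  As the
    Grabowski-Marmo bracket of two maps with at least one argument each is
    defined by the recursion
      [A, B](v) = (-1)^a [A, B(v)] + (-1)^<B, v> [A(v), B]
    (degrees taken after the shift by alpha), the point is that the stem bracket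
    satisfies this recursion.

    On the stem side, write q and q' for the corestrictions attached to A and B.
    The corestriction of the composite of the two coderivations is the sum
      q o q' (w) = sum of eps(I; J) (-1)^<q', U_I> q(U_I, q'(U_J, u_k), rest).
    Follow the first letter u of the word.  It may stand
    - in U_I, which leaves (-1)^<q', u> times the sum for q(u, -) and q';
    - in U_J, where the Koszul sign (-1)^<u, U_I> turns <q', U_I> into
      <q' + u, U_I>, the weight of q'(u, -), and leaves the sum for q and
      q'(u, -);
    - in the place of u_k with I and J empty, which leaves q(q'(u), rest).
    The last case is what inserting the vector q'(u) into q means.  So after
    adding to the sum the term q(q'(), w), which is zero unless q' is a vector,
    one gets for a map q' (insertion_cons)
      (q o q')(u, -) = (-1)^<q', u> q(u, -) o q' + q o q'(u, -),
    whether or not q(u, -) and q'(u, -) have become vectors.  The graded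
    commutator of q and q' inherits this Leibniz rule (nr_bracket_cons).

    It remains to compare signs: passing from A to q costs (-1)^(a(a+1)/2) and a
    sign from the tensor power of the shift, so that q(u, -) is the corestriction
    of A(v) up to (-1)^(a v_1) (corest_cons), and with the normalisation of the
    stem bracket everything adds up to the recursion above.  With the same
    normalisation the commutator formula also returns the prescribed bracket
    with a vector (skewh_nr_bracket), which starts the induction on the number of
    arguments (gmh_skewh). *)

Set Implicit Arguments.
Unset Strict Implicit.
Unset Printing Implicit Defensive.

Import Order.TTheory GRing.Theory Num.Theory.
Local Open Scope ring_scope.

(** * Signs and the degree pairing *)

Section Signs.
Variables (K : fieldType) (n : nat).
Implicit Types (x y z : int) (g h k : deg n).

Lemma sgnD x y : sgn K (x + y) = sgn K x * sgn K y.
Proof. by rewrite /sgn expfzDr // oppr_eq0 oner_eq0. Qed.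

(** The form in which signs are compared: z is half the difference of the
    exponents, and the premise is left to ring. *)
Lemma sgn_even x y z : x = y + z * 2 -> sgn K x = sgn K y.
Proof.
move=> ->; rewrite sgnD [z * 2]mulrC /sgn -[_ ^ (2 * z)]exprz_exp.
by rewrite -[_ ^ 2]/((-1) ^+ 2) sqrrN expr1n exp1rz mulr1.
Qed.

Lemma sgnV x : (sgn K x)^-1 = sgn K x.
Proof. by rewrite /sgn invr_expz -exprz_inv invrN invr1. Qed.

Lemma sgnN x : - sgn K x = sgn K (1 + x).
Proof. by rewrite sgnD /sgn expr1z mulN1r. Qed.

Lemma sgn_nat m : (-1) ^+ m = sgn K m%:Z.
Proof. by []. Qed.

Lemma pdotDl g h k : pdot (g + h) k = pdot g k + pdot h k.
Proof. by rewrite -big_split; apply: eq_bigr => i _; rewrite mxE mulrDl. Qed.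

Lemma pdotC g h : pdot g h = pdot h g.
Proof. by apply: eq_bigr => i _; rewrite mulrC. Qed.

Lemma pdotDr g h k : pdot g (h + k) = pdot g h + pdot g k.
Proof. by rewrite pdotC pdotDl !(pdotC g). Qed.

Lemma pdotNr g h : pdot g (- h) = - pdot g h.
Proof. by rewrite /pdot -sumrN; apply: eq_bigr => i _; rewrite mxE mulrN. Qed.

Lemma pdot_e1 z g : pdot (e1 n *~ z) g = z * g 0 0.
Proof.
have e i : (e1 n *~ z) 0 i = (i == 0)%:Z * z.
  by rewrite -scaler_int !mxE eqxx mulrC; case: (i == 0); rewrite intz.
rewrite /pdot (bigD1 0) //= e eqxx mul1r big1 ?addr0 // => i /negPf i0.
by rewrite e i0 !mul0r.
Qed.

Lemma pdotr_e1 z g : pdot g (e1 n *~ z) = z * g 0 0.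
Proof. by rewrite pdotC pdot_e1. Qed.

Lemma pdotr_e11 g : pdot g (e1 n) = g 0 0.
Proof. by rewrite -[e1 n]mulr1z pdotr_e1 mul1r. Qed.

Lemma e1_00 z : (e1 n *~ z) 0 0 = z.
Proof. by rewrite -scaler_int !mxE eqxx mulr1 intz. Qed.

Lemma upsgnE (T : Type) (w : seq (deg n * T)) : {e | upsgn K w = sgn K e}.
Proof.
elim: w => [|u w [e IHw]]; first by exists 0.
by rewrite /= IHw -sgnD; eexists.
Qed.

Lemma upsgnV (T : Type) (w : seq (deg n * T)) : (upsgn K w)^-1 = upsgn K w.
Proof. by have [e ->] := upsgnE w; rewrite sgnV. Qed.

End Signs.

(** * Coderivations and the first letter of a word *)

Section Insertion.
Variables (K : fieldType) (n : nat) (U : gspace K n).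

Notation word := (seq (deg n * U)).
Implicit Types (Q : deg n) (f q : word -> U) (w : word) (u : deg n * U).

(** A formal linear combination of words enters only through sums of this shape,
    with f a corestriction or the projection to one-letter words. *)
Lemma coder_sum Q q f w :
  \sum_(c <- coder Q q w) c.1 *: f c.2 =
  \sum_(k < size w) \sum_(I : {set 'I_(size w)} | I \subset before k)
    (koszul I (before k :\: I) * sgn K (pdot Q (tot (subword I)))) *:
    f (subword I ++
       (Q + (tot (subword (before k :\: I)) + (tnth (in_tuple w) k).1),
        q (subword (before k :\: I) ++ [:: tnth (in_tuple w) k])) ::
       drop k.+1 w).
Proof.
rewrite /coder big_allpairs_dep /= big_enum /=; apply: eq_bigr => k _.
by rewrite big_enum /=; apply: eq_bigl => I; rewrite powersetE.
Qed.

Lemma subword_cons u w (I : {set 'I_(size w).+1}) :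
  subword (w := u :: w) I =
  (if ord0 \in I then cons u else id)
    (subword (w := w) (lift ord0 @^-1: I)).
Proof.
have enum_set m (J : {set 'I_m}) : enum J = [seq i <- enum 'I_m | i \in J].
  by rewrite enumT; apply: eq_filter.
rewrite /subword !enum_set /= enum_ordSl /= filter_map.
have e : [seq tnth (in_tuple (u :: w)) i |
           i <- [seq lift ord0 i | i <- enum 'I_(size w) & lift ord0 i \in I]]
  = [seq tnth (in_tuple w) i | i <- enum 'I_(size w) & i \in lift ord0 @^-1: I].
  rewrite -map_comp (eq_filter (a2 := fun i => i \in lift ord0 @^-1: I));
    last by move=> i; rewrite inE.
  apply: (@eq_map _ _ _ (tnth (in_tuple w))) => i.
  by rewrite /= !(tnth_nth u).
by case: ifP => _; rewrite [LHS]/= e // (tnth_nth u).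
Qed.

Lemma sgn_tot_subword w (I : {set 'I_(size w)}) Q :
  \prod_(i in I) sgn K (pdot (tnth (in_tuple w) i).1 Q)
  = sgn K (pdot (tot (subword I)) Q).
Proof.
rewrite /tot big_map big_enum /=.
apply: (big_rec2 (fun x g => x = sgn K (pdot g Q))) => [|i x g _ ->].
  by rewrite /pdot big1 // => i _; rewrite mxE mul0r.
by rewrite pdotDl sgnD.
Qed.

(** The first letter is never preceded by another one, so it contributes a sign
    only when it belongs to J, and then it is passed by all of U_I. *)
Lemma koszul_cons u w (I J : {set 'I_(size w).+1}) :
  koszul (w := u :: w) I J =
  (if ord0 \in J
   then sgn K (pdot (tot (subword (w := w) (lift ord0 @^-1: I))) u.1) else 1) *
  koszul (w := w) (lift ord0 @^-1: I) (lift ord0 @^-1: J).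
Proof.
rewrite /koszul big_mkcond big_ord_recl /=.
rewrite [X in (if _ then X else _)]big1; last by case=> [[|i] hi] /andP[].
rewrite if_same mul1r.
have -> : (if ord0 \in J
   then sgn K (pdot (tot (subword (w := w) (lift ord0 @^-1: I))) u.1) else 1) =
  \prod_(i in lift ord0 @^-1: I)
     (if ord0 \in J then sgn K (pdot (tnth (in_tuple w) i).1 u.1) else 1).
  by case: ifP => _; rewrite ?sgn_tot_subword // big1.
rewrite -big_split /= [RHS]big_mkcond; apply: eq_bigr => i _.
rewrite inE; case: ifP => // _.
rewrite big_mkcond big_ord_recl /= andbT; congr (_ * _).
  by case: ifP => // _; rewrite !(tnth_nth u).
rewrite [RHS]big_mkcond; apply: eq_bigr => j _.
by rewrite inE /bump /= !add1n ltnS; case: ifP => // _; rewrite !(tnth_nth u).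
Qed.

(** A subset of {0, ..., m} is a subset of {1, ..., m} together with the answer
    to whether it contains 0. *)
Lemma big_set_ordS m (R : nmodType) (E : bool -> {set 'I_m} -> R) :
  \sum_(I : {set 'I_m.+1}) E (ord0 \in I) (lift ord0 @^-1: I) =
  \sum_(J : {set 'I_m}) E true J + \sum_(J : {set 'I_m}) E false J.
Proof.
pose h (c : bool * {set 'I_m}) : {set 'I_m.+1} :=
  [set i | if unlift ord0 i is Some j then j \in c.2 else c.1].
have h0 c : (ord0 \in h c) = c.1 by rewrite inE unlift_none.
have hl c : lift ord0 @^-1: h c = c.2 by apply/setP => j; rewrite !inE liftK.
have hK (I : {set _}) : h (ord0 \in I, lift ord0 @^-1: I) = I.
  by apply/setP => i; rewrite inE; case: unliftP => [j|] ->; rewrite ?inE.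
rewrite (reindex h) /=; last first.
  exists (fun I : {set _} => (ord0 \in I, lift ord0 @^-1: I)) => [c _|I _];
    last exact: hK.
  by rewrite h0 hl; case: c.
under eq_bigr do rewrite h0 hl.
by rewrite -(pair_bigA _ (fun b J => E b J)) big_bool.
Qed.

(** The first letter u lies in U_I (first sum), or in U_J (second sum), or it is
    u_k1, which forces I and J to be empty (last term).  In the second case
    moving u past U_I costs (-1)^<u, U_I>, which turns the sign (-1)^<Q, U_I> into
    that of weight Q + u. *)
Lemma coder_cons Q q f u w :
  \sum_(c <- coder Q q (u :: w)) c.1 *: f c.2 =
  sgn K (pdot Q u.1) *: (\sum_(c <- coder Q q w) c.1 *: f (u :: c.2))
  + \sum_(c <- coder (Q + u.1) (fun x => q (u :: x)) w) c.1 *: f c.2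
  + f ((Q + u.1, q [:: u]) :: w).
Proof.
rewrite !coder_sum (coder_sum Q q (fun x => f (u :: x))) /= big_ord_recl addrC.
congr (_ + _); last first.
  (* k = 0: no index is before k. *)
  have -> : before (@ord0 (size w)) = set0 by apply/setP => i; rewrite !inE.
  under eq_bigl do rewrite subset0.
  rewrite big_pred1_eq set0D /koszul big_set0 mul1r /subword enum_set0 /=.
  rewrite /tot big_nil drop0 add0r (tnth_nth u) /=.
  rewrite (_ : pdot Q 0 = 0) ?scale1r // /pdot big1 // => i _.
  by rewrite mxE mulr0.
rewrite scaler_sumr -big_split /=; apply: eq_bigr => k _.
have tk : tnth (in_tuple (u :: w)) (lift ord0 k) = tnth (in_tuple w) k.
  by rewrite !(tnth_nth u).
have bk : lift ord0 @^-1: before (lift ord0 k) = before k.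
  by apply/setP => i; rewrite !inE /bump /= ?add1n ?ltnS.
have sb (I : {set 'I_(size w).+1}) :
    (I \subset before (lift ord0 k)) = (lift ord0 @^-1: I \subset before k).
  rewrite -bk; apply/subsetP/subsetP => s i.
    by rewrite inE => /s; rewrite !inE.
  by case: (unliftP ord0 i) => [j|] ->; [move: (s j) | ]; rewrite !inE.
under eq_bigl do rewrite sb.
rewrite big_mkcond /=.
under eq_bigr => I _.
  rewrite koszul_cons !subword_cons preimsetD bk tk !inE /bump /= add1n andbT.
  over.
(* From here on J is the trace of I on the later letters, and b tells whether u
   lies in U_I; otherwise u lies in U_J. *)
rewrite (big_set_ordS (fun b J => if J \subset before k then
  ((if ~~ b then sgn K (pdot (tot (subword (w := w) J)) u.1) else 1) *
     koszul (w := w) J (before k :\: J) *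
     sgn K (pdot Q (tot ((if b then cons u else id) (subword (w := w) J))))) *:
  f ((if b then cons u else id) (subword (w := w) J) ++
     (Q + (tot ((if ~~ b then cons u else id) (subword (w := w) (before k :\: J)))
           + (tnth (in_tuple w) k).1),
      q ((if ~~ b then cons u else id) (subword (w := w) (before k :\: J))
         ++ [:: tnth (in_tuple w) k]))
     :: drop k.+1 w) else 0)) /=.
rewrite -!big_mkcond /= scaler_sumr; congr (_ + _); apply: eq_bigr => J _.
  rewrite mul1r scalerA /tot big_cons pdotDr sgnD; congr (_ *: _).
  by rewrite mulrCA.
rewrite /tot big_cons addrA addrA -/(tot _); congr (_ *: f (_ ++ (_, _) :: _)).
  by rewrite pdotDl sgnD (pdotC (tot _)); ring.
by rewrite -!addrA.
Qed.

(** The trace of multilinearity on words: with a = 0 it says that a word with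
    a zero letter is sent to 0. *)
Definition letter_scaling q : Prop :=
  forall w1 w2 d (a : K) (v : U),
    q (w1 ++ (d, a *: v) :: w2) = a *: q (w1 ++ (d, v) :: w2).

Definition word_arity p q : Prop := forall w, size w != p -> q w = 0.

Lemma letter_scaling0 q w1 w2 d : letter_scaling q -> q (w1 ++ (d, 0) :: w2) = 0.
Proof. by move=> hq; rewrite -(scale0r (0 : U)) hq !scale0r. Qed.

Lemma letter_scaling_cons q u : letter_scaling q ->
  letter_scaling (fun w => q (u :: w)).
Proof. by move=> hq w1 w2 d a v; rewrite -!cat_cons hq. Qed.

Lemma word_arity_cons p q u : word_arity p q ->
  word_arity p.-1 (fun w => q (u :: w)).
Proof. by move=> hq w hw; apply: hq; case: p hw. Qed.

(** The corestriction of the composite of two coderivations, where Q is the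
    weight of q', plus a term that vanishes when q' takes at least one argument.
    When q' is a vector, that term alone remains, and it is the insertion of the
    vector in the first place.  This makes vectors subject to the same rules as
    maps. *)
Definition insertion Q q q' w : U :=
  q ((Q, q' [::]) :: w) + \sum_(c <- coder Q q' w) c.1 *: q c.2.

Lemma sum_coder_nil Q q f : \sum_(c <- coder Q q [::]) c.1 *: f c.2 = 0.
Proof. by rewrite coder_sum big_ord0. Qed.

Lemma sum_coder0 Q q f w : (forall u w, f (u :: w) = 0) ->
  \sum_(c <- coder Q q w) c.1 *: f c.2 = 0.
Proof.
move=> f0; rewrite coder_sum big1 // => k _; rewrite big1 // => I _.
by case: (subword I) => [|? ?] /=; rewrite f0 scaler0.
Qed.

Lemma insertion_arity0l Q q q' w : word_arity 0 q -> insertion Q q q' w = 0.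
Proof.
by move=> hq; rewrite /insertion sum_coder0 ?hq ?addr0 // => *; rewrite hq.
Qed.

Lemma insertion_arity0r Q q q' w : letter_scaling q -> word_arity 0 q' ->
  insertion Q q q' w = q ((Q, q' [::]) :: w).
Proof.
move=> hq hq'; rewrite /insertion coder_sum big1 ?addr0 // => k _.
rewrite big1 // => I _; rewrite hq' ?letter_scaling0 ?scaler0 //.
by rewrite size_cat addn1.
Qed.

(** This is coder_cons, its last term being the extra term of the second insertion
    on the right: when q' has one argument, q'(u, -) is a vector. *)
Lemma insertion_cons Q q q' u w : letter_scaling q -> q' [::] = 0 ->
  insertion Q q q' (u :: w) =
  sgn K (pdot Q u.1) *: insertion Q (fun x => q (u :: x)) q' w
  + insertion (Q + u.1) q (fun x => q' (u :: x)) w.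
Proof.
move=> hq hq'; rewrite /insertion hq' coder_cons (letter_scaling0 [::]) //.
by rewrite (letter_scaling0 [:: u]) // !add0r -addrA [X in _ + X]addrC.
Qed.

Lemma insertionZl Q a q1 q q' w : (forall w, q1 w = a *: q w) ->
  insertion Q q1 q' w = a *: insertion Q q q' w.
Proof.
move=> hq; rewrite /insertion hq scalerDr scaler_sumr; congr (_ + _).
by apply: eq_bigr => c _; rewrite hq !scalerA mulrC.
Qed.

Lemma insertionZr Q a q q1 q' w : letter_scaling q ->
  (forall w, q1 w = a *: q' w) ->
  insertion Q q q1 w = a *: insertion Q q q' w.
Proof.
move=> hq hq'; rewrite /insertion scalerDr hq' (hq [::]); congr (_ + _).
rewrite !coder_sum scaler_sumr; apply: eq_bigr => k _.
rewrite scaler_sumr; apply: eq_bigr => I _.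
by rewrite hq' hq !scalerA mulrC.
Qed.

Lemma insertion_arity p p' Q q q' w :
  letter_scaling q -> word_arity p q -> word_arity p' q' ->
  (size w).+1 != (p + p')%N -> insertion Q q q' w = 0.
Proof.
elim: w p p' Q q q' => [|u w IHw] p [|p'] Q q q' hq aq aq' hw;
  try by rewrite insertion_arity0r // aq //; move: hw; rewrite /= addn0.
  by rewrite /insertion sum_coder_nil aq' // (letter_scaling0 [::]) // addr0.
rewrite insertion_cons ?aq' // (IHw p p' (Q + u.1)) //; last first.
- by move: hw; rewrite /= addnS eqSS.
- exact: (word_arity_cons u aq').
case: p hw aq => [|p] hw aq.
  by rewrite insertion_arity0l ?scaler0 ?addr0 // => x _; apply: aq.
rewrite (IHw p p'.+1) ?scaler0 ?addr0 //.
- exact: letter_scaling_cons.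
- exact: (word_arity_cons u aq).
Qed.

(** A one-letter word comes only from the term with I empty and k last. *)
Lemma tproj_coder Q q w : q [::] = 0 -> tproj (coder Q q w) = q w.
Proof.
pose f w := if w is [:: u] then u.2 else 0 : U.
have -> : tproj (coder Q q w) = \sum_(c <- coder Q q w) c.1 *: f c.2.
  apply: eq_bigr => c _; rewrite /f.
  by case: c.2 => [|? []] //; rewrite scaler0.
case: w => [->|u w _]; first by rewrite sum_coder_nil.
elim: w u Q q => [|v w IHw] u Q q; rewrite coder_cons.
  rewrite sum_coder_nil (@sum_coder_nil _ _ (fun x => f (u :: x))).
  by rewrite scaler0 !add0r.
by rewrite IHw (@sum_coder0 _ _ (fun x => f (u :: x))) // scaler0 add0r addr0.
Qed.

Lemma tproj_text Q q (t : seq (K * word)) : q [::] = 0 ->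
  tproj (text (coder Q q) t) = \sum_(c <- t) c.1 *: q c.2.
Proof.
move=> q0; rewrite /tproj /text big_allpairs_dep /=.
apply: eq_bigr => c _; rewrite -(tproj_coder Q _ q0) scaler_sumr.
by apply: eq_bigr => d _ /=; case: d.2 => [|? []]; rewrite ?scaler0 ?scalerA.
Qed.

Lemma tproj_gcomm Q q Q' q' w : q [::] = 0 -> q' [::] = 0 ->
  letter_scaling q -> letter_scaling q' ->
  tproj (gcomm Q Q' (coder Q q) (coder Q' q') w) =
  insertion Q' q q' w - sgn K (pdot Q Q') *: insertion Q q' q w.
Proof.
move=> q0 q'0 hq hq'; rewrite /gcomm /tproj big_cat /= -!/(tproj _).
rewrite /insertion q0 q'0 (letter_scaling0 [::]) //.
rewrite (letter_scaling0 [::] w Q) // !add0r.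
rewrite tproj_text // -scaleNr -(tproj_text Q' (coder Q q w) q'0) scaler_sumr.
congr (_ + _); rewrite [tproj (tscale _ _)]big_map; apply: eq_bigr => c _ /=.
by case: c.2 => [|? []]; rewrite ?scaler0 ?scalerA.
Qed.

End Insertion.

(** * The commutator formula for the stem bracket *)

(** Regrouping of the four terms of a commutator after the first argument has
    been distributed; the premises are the sign identities. *)
Lemma scale_commutatorE (K : fieldType) (M : lmodType K) (X1 X2 Y1 Y2 : M)
    (s a1 a2 b c d1 d2 e t r m t' r' m' : K) :
  s * (a1 * a2) = t' * r' -> s * b = t * r -> s * (c * (d1 * d2)) = t * (r * m) ->
  s * (c * e) = t' * (r' * m') ->
  s *: (a1 *: (a2 *: X1) + b *: X2 - c *: (d1 *: (d2 *: Y1) + e *: Y2)) =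
  t *: (r *: (X2 - m *: Y1)) + t' *: (r' *: (X1 - m' *: Y2)).
Proof.
move=> h1 h2 h3 h4.
rewrite !scalerBr !scalerDr !scalerA -!mulrA h1 h2 h3 h4 !mulrA.
by rewrite [in RHS]addrACA -opprD [X in X - _]addrC.
Qed.

Section Brackets.
Variables (K : fieldType) (n : nat) (V : gspace K n).
Implicit Types (F G : seq V -> V) (C D : deg n) (p q : nat).

Notation down := (shiftg (e1 n) V).

(** The corestriction attached to a map with p = a + 1 arguments, since
    a (a + 1) / 2 is the binomial coefficient of p over 2; it also makes sense for
    a vector, p = 0. *)
Definition corest p F (w : seq (deg n * down)) : down :=
  (-1) ^+ 'C(p, 2) *: sh (e1 n) (upsgn K w *: F [seq unsh u.2 | u <- w]).

(** C + a e_1 with a = p - 1, including a = - 1 for vectors. *)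
Definition coder_weight p C : deg n := C + e1 n *~ (p%:Z - 1).

Definition down_word (l : seq (deg n * V)) : seq (deg n * down) :=
  [seq (x.1 - e1 n, sh (e1 n) x.2) | x <- l].

(** The commutator formula for the stem bracket, which on skew-symmetric maps is
    the Nijenhuis-Richardson bracket, of maps with p = a + 1 and q = b + 1
    arguments, written so that a and b may be - 1.  The binomial coefficient is
    c (c + 1) / 2 for c = a + b; the truncation in (p + q).-1 occurs only for
    p = q = 0, where the bracket is 0. *)
Definition nr_bracket p C F q D G (l : seq (deg n * V)) : V :=
  let w := down_word l in
  let P := coder_weight p C in let Q := coder_weight q D in
  (sgn K (1 + (p%:Z - 1) * (q%:Z - 1 + D 0 0)) *
   sgn K 'C((p + q).-1, 2) * upsgn K w) *:
  unsh (insertion Q (corest p F) (corest q G) w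
   - sgn K (pdot P Q) *: insertion P (corest q G) (corest p F) w).

Lemma corest_letter_scaling p F : multilinear F -> letter_scaling (corest p F).
Proof.
move=> hF w1 w2 d a v; have F0 l1 l2 : F (l1 ++ 0 :: l2) = 0.
  have := hF l1 l2 (-1) 0 0; rewrite scaler0 addr0 => {1}->.
  by rewrite scaleN1r addNr.
rewrite /corest !map_cat /= /sh /unsh.
have -> l1 l2 : F (l1 ++ (a *: v) :: l2) = a *: F (l1 ++ v :: l2).
  by rewrite -[X in _ ++ X :: _]addr0 hF F0 addr0.
rewrite !scalerA; congr (_ *: _).
have -> (b : down) :
    upsgn K (w1 ++ (d, b) :: w2) = upsgn K (w1 ++ (d, v) :: w2).
  by elim: w1 => //= u w1 ->; rewrite !size_cat.
by rewrite [LHS]mulrA [LHS]mulrC [LHS]mulrA.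
Qed.

Lemma corest_arity p F : arity p F -> word_arity p (corest p F).
Proof. by move=> aF w hw; rewrite /corest aF ?scaler0 // size_map. Qed.

(** Fixing the first argument changes a (a + 1) / 2 by a, and moving the remaining
    a shifts of degree e_1 past the first letter, of degree g - e_1, costs
    a (g_1 - 1); together a g_1. *)
Lemma corest_cons p F g v w : arity p.+1 F ->
  corest p.+1 F ((g - e1 n, sh (e1 n) v) :: w) =
  sgn K (p%:Z * g 0 0) *: corest p (fun l => F (v :: l)) w.
Proof.
move=> aF; have [wp|wp] := eqVneq (size w) p; last first.
  by rewrite /corest !aF /= ?size_map ?eqSS // /sh !scaler0.
rewrite /corest /= wp /sh /unsh !scalerA; congr (_ *: _).
have [e ->] := upsgnE K w.
rewrite !sgn_nat -!sgnD binS bin1 PoszD pmulrn pdot_e1 !mxE eqxx /=.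
by apply: (@sgn_even _ _ _ 0); ring.
Qed.

Lemma coder_weight_cons p C g :
  coder_weight p.+1 C + (g - e1 n) = coder_weight p (C + g).
Proof.
rewrite /coder_weight addrACA -[X in _ - X]mulr1z -mulrzBr; congr (_ + _ *~ _).
by rewrite intS; ring.
Qed.

Lemma arity_cons p F v : arity p.+1 F -> arity p (fun l => F (v :: l)).
Proof. by move=> aF l hl; apply: aF. Qed.

Lemma multilinear_cons F v : multilinear F -> multilinear (fun l => F (v :: l)).
Proof. by move=> mF l1 l2 c x y; rewrite -!cat_cons mF. Qed.

(** Needed because the sign of the tensor power of the shift depends on the length
    of the word, and agrees with the signs of the recursion only for words of the
    right length. *)
Lemma nr_bracket_arity p C F q D G l : arity p F -> multilinear F -> arity q G ->
  multilinear G -> (size l).+1 != (p + q)%N -> nr_bracket p C F q D G l = 0.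
Proof.
move=> aF mF aG mG hl; rewrite /nr_bracket.
have szl : (size (down_word l)).+1 != (p + q)%N by rewrite size_map.
have szl' : (size (down_word l)).+1 != (q + p)%N by rewrite addnC.
rewrite (insertion_arity _ (corest_letter_scaling p mF) (corest_arity aF)
  (corest_arity aG) szl).
rewrite (insertion_arity _ (corest_letter_scaling q mG) (corest_arity aG)
  (corest_arity aF) szl').
by rewrite scaler0 subr0 /unsh scaler0.
Qed.

(** The Leibniz rule of insertion_cons for both halves of the commutator.  In
    terms of corestrictions [q, q'](u) = (-1)^<q', u> [q(u), q'] + [q, q'(u)]; the
    normalising signs turn this into the recursion that defines the
    Grabowski-Marmo bracket. *)
Lemma nr_bracket_cons p C F q D G g v l : arity p.+1 F -> multilinear F ->
  arity q.+1 G -> multilinear G ->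
  nr_bracket p.+1 C F q.+1 D G ((g, v) :: l) =
  sgn K p%:Z *: nr_bracket p.+1 C F q (D + g) (fun x => G (v :: x)) l
  + sgn K (pdot D g) *: nr_bracket p (C + g) (fun x => F (v :: x)) q.+1 D G l.
Proof.
move=> aF mF aG mG.
have [lpq|lpq] := eqVneq (size l) (p + q)%N; last first.
  by rewrite !nr_bracket_arity ?scaler0 ?addr0 ?addnS ?addSn ?eqSS //;
    first [exact: arity_cons | exact: multilinear_cons].
rewrite /nr_bracket.
have -> : down_word ((g, v) :: l)
  = (g - e1 n, sh (e1 n) v) :: down_word l by [].
have F0 : corest p.+1 F [::] = 0 by exact: corest_arity.
have G0 : corest q.+1 G [::] = 0 by exact: corest_arity.
rewrite !insertion_cons //; try exact: corest_letter_scaling.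
rewrite !coder_weight_cons [X in upsgn K X]/=.
rewrite !(insertionZl _ _ _ (fun w => corest_cons g v w aF)).
rewrite !(insertionZl _ _ _ (fun w => corest_cons g v w aG)).
rewrite !(insertionZr _ _ (corest_letter_scaling _ mF)
  (fun w => corest_cons g v w aG)).
rewrite !(insertionZr _ _ (corest_letter_scaling _ mG)
  (fun w => corest_cons g v w aF)).
set w := down_word l.
(* X1, X2 insert the second map into the first one; Y1, Y2 the first into the
   second one. *)
set X1 := insertion (coder_weight q.+1 D) _ _ _.
set X2 := insertion (coder_weight q _) _ _ _.
set Y1 := insertion (coder_weight p.+1 C) _ _ _.
set Y2 := insertion (coder_weight p _) _ _ _.
have [e We] := upsgnE K w.
rewrite /= We size_map lpq /unsh.
apply: (@scale_commutatorE K V X1 X2 Y1 Y2).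
all: rewrite ?addnS -?pred_Sn ?binS ?bin1 ?PoszD -!sgnD ?pmulrn.
all: rewrite /coder_weight.
all: rewrite ?(pdotDl, pdotDr, pdotNr, pdot_e1, pdotr_e1, pdotr_e11, mxE).
all: rewrite ?intS ?PoszD ?eqxx ?mulr1 ?e1_00.
- by apply: (@sgn_even _ _ _ ((p%:Z + q%:Z) * g 0 0)); ring.
- by apply: (@sgn_even _ _ _ (q%:Z * g 0 0)); ring.
- by apply: (@sgn_even _ _ _ (q%:Z * g 0 0)); ring.
- rewrite (pdotC g D).
  apply: (@sgn_even _ _ _ (p%:Z * g 0 0 + q%:Z + D 0 0 - pdot D g)).
  by ring.
Qed.

Lemma corest0 F w : arity 0 F -> corest 0 F w = if w is [::] then F [::] else 0.
Proof.
move=> aF; case: w => [|u w]; last by rewrite corest_arity.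
by rewrite /corest /= expr0 !scale1r.
Qed.

Lemma vals_down_word (l : seq (deg n * V)) :
  [seq unsh u.2 | u <- down_word l] = vals l.
Proof. by rewrite -map_comp. Qed.

(** If one of the maps is a vector y, only its insertion y, v_1, v_2 ... into the
    other map survives in the commutator formula, and the normalising signs reduce
    to those prescribed for the bracket with a vector. *)
Lemma skewh_nr_bracket p C F q D G l : arity p F -> multilinear F -> arity q G ->
  multilinear G -> skewh p C F q D G l = nr_bracket p C F q D G l.
Proof.
move=> aF mF aG mG.
have sF := corest_letter_scaling p mF; have sG := corest_letter_scaling q mG.
have cF := corest_arity aF; have cG := corest_arity aG.
rewrite /nr_bracket; case: p q => [|p] [|q] in aF aG sF sG cF cG *.
- by rewrite !insertion_arity0l // scaler0 subr0 /unsh scaler0.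
- rewrite insertion_arity0l // insertion_arity0r // (sub0r (_ *: _)).
  have [lq|lq] := eqVneq (size l) q; last first.
    rewrite /= aG ?cG /= ?size_map // !scaler0.
    by rewrite oppr0 /unsh scaler0.
  rewrite corest0 // /corest /= vals_down_word.
  have [e We] := upsgnE K (down_word l).
  rewrite size_map lq We /unsh /sh -!scaleNr !scalerA; congr (_ *: _).
  rewrite !sgnN !sgn_nat -!sgnD binS bin1 ?pmulrn /coder_weight.
  rewrite !(pdotDl, pdotDr, pdot_e1, pdotr_e1, mxE).
  rewrite e1_00 !intS !PoszD mulr1n.
  apply: (@sgn_even _ _ _
    (q%:Z + D 0 0 - 'C(q, 2)%:Z - e - q%:Z * C 0 0)).
  by ring.
- rewrite (insertion_arity0l _ _ _ cG) insertion_arity0r //.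
  rewrite scaler0 subr0.
  have [lp|lp] := eqVneq (size l) p; last first.
    by rewrite /= aF ?cF /= ?size_map // /unsh !scaler0.
  rewrite corest0 // /corest /= vals_down_word addn0.
  have [e We] := upsgnE K (down_word l).
  rewrite size_map lp We /unsh /sh !scalerA; congr (_ *: _).
  rewrite !sgn_nat -!sgnD binS bin1 ?pmulrn /coder_weight.
  rewrite !(pdotDr, pdot_e1, mxE).
  rewrite !intS !PoszD mulr1n.
  by apply: (@sgn_even _ _ _ (- (p%:Z * D 0 0 + 'C(p, 2)%:Z + e))); ring.
- have -> : skewh p.+1 C F q.+1 D G l = stemh p C F q D G l by [].
  have phiE r E (H : seq V -> V) :
      phi E r H = coder (coder_weight r.+1 E) (corest r.+1 H).
    rewrite /phi /corest /coder_weight intS addrAC subrr add0r -pmulrn.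
    by rewrite bin2 mulnC.
  rewrite /stemh /phi_inv !phiE -/(down_word l).
  have wtE r E : E + e1 n *+ r = coder_weight r.+1 E.
    by rewrite /coder_weight intS addrAC subrr add0r -pmulrn.
  rewrite !wtE tproj_gcomm // ?cF ?cG // upsgnV scalerA; congr (_ *: _).
  rewrite mulrA; congr (_ * _); rewrite addSn /= addnS bin2 mulnC sgn_nat.
  congr (sgn K _ * _).
  by rewrite !pmulrn pdot_e1 mxE e1_00 !intS; ring.
Qed.

End Brackets.

(** * The shift by alpha *)

Section Shift.
Variables (K : fieldType) (n : nat) (V : gspace K n) (alpha : deg n).

(** The recursion for the Grabowski-Marmo bracket adds g - alpha to the index of
    A(v) when v has degree g, which is the degree of v in the shifted space. *)
Lemma gmh_skewh p C (F : seq V -> V) q D G (l : seq (deg n * shiftg alpha V)) :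
  arity p F -> multilinear F -> arity q G -> multilinear G ->
  gmh alpha p C F q D G [seq (x.1 + alpha, unsh x.2) | x <- l] =
  skewh (V := shiftg alpha V) p C F q D G l.
Proof.
have valsE (k : seq (deg n * shiftg alpha V)) :
    vals [seq (x.1 + alpha, unsh x.2) | x <- k] = vals k :> seq V.
  by rewrite /vals -map_comp.
elim: l p C F q D G => [|[g v] l IHl] [|p] C F [|q] D G aF mF aG mG;
  rewrite /= ?valsE //.
  rewrite -[RHS]/(skewh (V := shiftg alpha V) p.+1 C F q.+1 D G [::]).
  by rewrite skewh_nr_bracket // nr_bracket_arity // addnS.
rewrite -[RHS]/(skewh (V := shiftg alpha V) p.+1 C F q.+1 D G ((g, v) :: l)).
rewrite skewh_nr_bracket // nr_bracket_cons // !addrK !IHl -?skewh_nr_bracket //;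
  first [exact: (arity_cons (V := shiftg alpha V))
       | exact: (multilinear_cons (V := shiftg alpha V))].
Qed.

Lemma hext_shift (f : seq (deg n * V) -> V) (l : seq V) :
  hext f l = hext (V := shiftg alpha V)
    (fun k => f [seq (x.1 + alpha, unsh x.2) | x <- k]) l.
Proof.
elim: l f => //= v l IHl f; rewrite big_map; apply: eq_bigr => g _.
by rewrite subrK IHl.
Qed.

(** The shift being the identity of the underlying space, tilde only changes the
    degrees given to vectors. *)
Lemma tilde_id (F : ofam V) : tilde alpha F = F.
Proof.
apply/funext => p; apply/funext => C; apply/funext => l.
by rewrite /tilde map_id.
Qed.

End Shift.

Theorem proposition13 (K : fieldType) (charK : [pchar K]%R =i pred0) (n : nat)
    (A : algType K) (gr : grading n A) (hA : graded_comm gr) (alpha : deg n)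
    (F G : ofam (GSpace gr)) (hF : Diff1 alpha F) (hG : Diff1 alpha G) :
  tilde alpha (gm_bracket alpha F G)
  = skew_bracket (tilde alpha F) (tilde alpha G).
Proof.
case: hF hG => _ hF [_ hG]; rewrite !tilde_id.
apply/funext => r; apply/funext => C; apply/funext => l.
rewrite /gm_bracket /skew_bracket /famext (hext_shift alpha).
congr (hext _ l); apply/funext => w.
apply: eq_bigr => p _; apply: eq_fsbigr => D _.
have [aF mF _ _ _] := hF p D.
have [aG mG _ _ _] := hG (r.+1 - p)%N (C - D).
exact: (@gmh_skewh K n (GSpace gr) alpha _ _ _ _ _ _ w aF mF aG mG).
Qed.
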